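(* Let $K$ be a field of characteristic $p>0$ (not necessarily algebraically closed) with algebraic closure $\overline K$, and let $f(x)\in K[x]$ be a monic polynomial that has at least two distinct roots in $\overline K$. Write $G_f(\overline K)=\widetilde G_f(\overline K)\rtimes\overline G_f(\overline K)$ where $\overline G_f(\overline K)=\langle\sigma_{\lambda_n,(1-\lambda_n)\nu}\rangle$ and $\widetilde G_f(\overline K)=\{\sigma_{1,\mu}\mid\mu\in\overline V\}$, $\lambda_n\in\overline K$ is a primitive $n$'th root of unity, $\nu\in\overline K$, and $\overline V$ is a finite dimensional $\mathbb F_p(\lambda_n)$-subspace of $\overline K$. Then: 1. $\widetilde G_f(K)=\{e\}$ if and only if $\overline V\cap K=0$. 2. $\overline G_f(K)=\{e\}$ if and only if $\overline G_f(\overline K)=\{e\}$, or otherwise $\overline G_f(\overline K)=\langle\sigma_{\lambda_n,(1-\lambda_n)\nu}\rangle$ and there is no natural number $i'$ with $1\le i'\le n-1$ such that $i'|n$, $\lambda_n^{i'}\in K$ and $(1-\lambda_n^{i'})\nu\in\overline V+K$. 3. $G_f(K)=\{e\}$ if and only if $G_f(\overline K)=\{e\}$, or otherwise $\overline V\cap K=0$, $\overline G_f(\overline K)=\langle\sigma_{\lambda_n,(1-\lambda_n)\nu}\rangle$ and there is no natural number $i'$ with $1\le i'\le n-1$ such that $i'|n$, $\lambda_n^{i'}\in K$ and $(1-\lambda_n^{i'})\nu\in\overline V+K$.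
   Context: For a field $L$ of characteristic $p$: $\mathrm{Aut}_L(L[x])=\{\sigma_{\lambda,\mu}\mid\lambda\in L^\times,\mu\in L\}$, $\sigma_{\lambda,\mu}(x)=\lambda x+\mu$; $\mathrm{Sh}(L)=\{\sigma_{1,\mu}\mid\mu\in L\}$. The eigengroup of $f\in L[x]$ is $G_f(L)=\{\sigma\in\mathrm{Aut}_L(L[x])\mid\sigma(f)\in L^\times f\}$. When $f$ has at least two distinct roots in $\overline K$, the group $G_f(L)$ is finite ($L=K$ or $\overline K$) and $G_f(L)=\widetilde G_f(L)\rtimes\overline G_f(L)$, where $\widetilde G_f(L)=G_f(L)\cap\mathrm{Sh}(L)$ and $\overline G_f(L)$ is a cyclic complement of the form $\langle\sigma_{\lambda_m,(1-\lambda_m)\nu'}\rangle$ with $\lambda_m\in L$ a primitive $m$'th root of unity and $\nu'\in L$. So $\overline G_f(L)=\{e\}$ means $G_f(L)=\widetilde G_f(L)$. If $\overline G_f(\overline K)=\{e\}$ we take $n=1$, $\lambda_1=1$ (so that there is no $i'$ with $1\le i'\le n-1$). *)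

(* Defs.v *)
From HB Require Import structures.
From mathcomp Require Import all_boot all_order all_algebra.
From mathcomp Require Import boolp classical_sets.

Set Implicit Arguments.
Unset Strict Implicit.
Unset Printing Implicit Defensive.

Import GRing.Theory.
Local Open Scope ring_scope.
Local Open Scope classical_set_scope.

(* Groups of bijections of a possibly infinite type T are sets of functions
   T -> T; the product is composition and the unit is idfun. *)
Definition is_subgroup (T : Type) (G : set (T -> T)) : Prop :=
  [/\ G idfun,
      forall s t, G s -> G t -> G (s \o t)
    & forall s, G s -> exists2 t, G t & cancel s t /\ cancel t s].

Definition generated (T : Type) (A : set (T -> T)) : set (T -> T) :=
  smallest (@is_subgroup T) A.

(* G = N ><| H, as an internal semidirect product. *)
Definition semidirect (T : Type) (G N H : set (T -> T)) : Prop :=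
  [/\ [/\ is_subgroup G, is_subgroup N & is_subgroup H],
      forall g g' s, G g -> cancel g g' -> cancel g' g ->
        N s -> N (g \o s \o g'),
      N `&` H = [set idfun]
    & G = [set s \o t | s in N & t in H]].

Definition sigma (L : fieldType) (lambda mu : L) : {poly L} -> {poly L} :=
  fun g => g \Po (lambda *: 'X + mu%:P).

Definition AutPoly (L : fieldType) : set ({poly L} -> {poly L}) :=
  [set s | bijective s /\
     exists phi : {lrmorphism {poly L} -> {poly L}}, s = phi].
Arguments AutPoly L : clear implicits.

Definition Sh (L : fieldType) : set ({poly L} -> {poly L}) :=
  [set sigma 1 mu | mu in [set: L]].
Arguments Sh L : clear implicits.

Definition eigengroup (L : fieldType) (f : {poly L}) :
    set ({poly L} -> {poly L}) :=
  [set s | AutPoly L s /\ exists2 c : L, c != 0 & s f = c *: f].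

Definition shift_eigengroup (L : fieldType) (f : {poly L}) :
    set ({poly L} -> {poly L}) :=
  eigengroup f `&` Sh L.

(* Such an H is in general only unique up to conjugation. H is trivial exactly
   when m = 1, in which case lambda = 1. *)
Definition cyclic_complement_with (L : fieldType) (f : {poly L})
    (H : set ({poly L} -> {poly L})) (m : nat) (lambda nu : L) : Prop :=
  [/\ m.-primitive_root lambda,
      H = generated [set sigma lambda ((1 - lambda) * nu)]
    & semidirect (eigengroup f) (shift_eigengroup f) H].

Definition cyclic_complement (L : fieldType) (f : {poly L})
    (H : set ({poly L} -> {poly L})) : Prop :=
  exists (m : nat) (lambda nu : L), cyclic_complement_with f H m lambda nu.

Definition is_subfield (L : fieldType) (F : set L) : Prop :=
  [/\ F 1,
      forall x y, F x -> F y -> F (x - y)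
    & forall x y, F x -> F y -> F (x / y)].

(* The prime field of L with z adjoined: F_p(z) when L has characteristic p. *)
Definition prime_adjoin (L : fieldType) (z : L) : set L :=
  smallest (@is_subfield L) [set z].

Definition is_findim_subspace (L : fieldType) (F V : set L) : Prop :=
  [/\ V 0,
      forall x y, V x -> V y -> V (x + y),
      forall c x, F c -> V x -> V (c * x)
    & exists (d : nat) (b : 'I_d -> L), (forall i, V (b i)) /\
        forall x, V x -> exists c : 'I_d -> L,
          (forall i, F (c i)) /\ x = \sum_(i < d) c i * b i].

Definition is_algebraic_closure (K : fieldType) (L : closedFieldType)
    (iota : {rmorphism K -> L}) : Prop :=
  forall x : L, algebraicOver iota x.

(* K is viewed inside L through iota; the last clause says that
   (1 - lambda ^+ i) * nu lies in V + K. *)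
Definition descends_at (K L : fieldType) (iota : {rmorphism K -> L})
    (V : set L) (n : nat) (lambda nu : L) (i : nat) : Prop :=
  [/\ (1 <= i <= n - 1)%N,
      (i %| n)%N,
      range iota (lambda ^+ i)
    & exists v k, V v /\ (1 - lambda ^+ i) * nu = v + iota k].

(* Main.v *)
Require Import Defs.
From HB Require Import structures.
From mathcomp Require Import all_boot all_order all_algebra.
From mathcomp Require Import boolp classical_sets.

(** The eigengroup of [f] over [Kbar] consists of the [sigma (lambda ^+ i)
    (v + (1 - lambda ^+ i) * nu)] with [v] in [V], and the eigengroup over [K]
    consists of those of its elements whose two parameters lie in [K]. So the
    latter contains a non-shift iff some [i] not divisible by [n] satisfies
    [lambda ^+ i \in K] and [(1 - lambda ^+ i) * nu \in V + K]; raising that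
    element to a Bezout power replaces [i] by its gcd with [n]. *)

Set Implicit Arguments.
Unset Strict Implicit.
Unset Printing Implicit Defensive.

Import GRing.Theory.
Local Open Scope ring_scope.
Local Open Scope classical_set_scope.

(** * Affine substitutions as the automorphisms of [L[x]] *)

Lemma sigma_comp (L : fieldType) (a b c d : L) :
  sigma a b \o sigma c d = sigma (c * a) (c * b + d).
Proof.
apply: funext => g; rewrite /sigma /= -comp_polyA; congr (_ \Po _).
rewrite comp_polyD comp_polyZ comp_polyX comp_polyC scalerDr scalerA.
by rewrite -addrA polyCD polyCM mul_polyC.
Qed.

Lemma sigma10 (L : fieldType) : sigma (1 : L) 0 = idfun.
Proof. by apply: funext => g; rewrite /sigma scale1r addr0 comp_polyXr. Qed.

Lemma sigma_inj (L : fieldType) (a b c d : L) :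
  sigma a b = sigma c d -> a = c /\ b = d.
Proof.
move=> /(congr1 (fun s => s 'X)); rewrite /sigma !comp_polyX => E.
split.
- by move/(congr1 (fun q : {poly L} => q`_1)): E; rewrite !coefE !mulr1 !addr0.
- by move/(congr1 (fun q : {poly L} => q`_0)): E; rewrite !coefE !mulr0 !add0r.
Qed.

(** An algebra endomorphism is composition with its value at ['X]. Degrees multiply under
    composition and some polynomial is sent to ['X], so this value has degree one. *)
Lemma AutPolyP (L : fieldType) (s : {poly L} -> {poly L}) :
  AutPoly L s <-> exists a b, a != 0 /\ s = sigma a b.
Proof.
split=> [[[t st ts] [phi sE]] | [a [b [a0 ->]]]].
- have sP g : s g = g \Po s 'X.
    rewrite sE -[g in LHS]coefK poly_def linear_sum comp_polyE.
    by apply: eq_bigr => i _; rewrite linearZ rmorphXn.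
  have /eqP szq : size (s 'X) == 2.
    have := size_comp_poly (t 'X) (s 'X); rewrite -sP ts size_polyX /=.
    by move/esym/eqP; rewrite muln_eq1 => /andP[_]; case: size => [|[|[]]].
  exists (s 'X)`_1, (s 'X)`_0; split.
    have <- : lead_coef (s 'X) = (s 'X)`_1 by rewrite lead_coefE szq.
    by rewrite lead_coef_eq0 -size_poly_eq0 szq.
  apply: funext => g; rewrite sP /sigma; congr (_ \Po _).
  rewrite -[LHS]coefK szq poly_def big_ord_recl big_ord1 /= expr0 expr1.
  by rewrite alg_polyC addrC.
- split; last by exists (comp_poly (a *: 'X + b%:P)).
  have E (x y : {poly L} -> {poly L}) : y \o x = idfun -> cancel x y.
    by move=> + g => /(congr1 (fun h => h g)).
  (* The inverse comes from solving [y = a x + b] for [x]. *)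
  exists (sigma a^-1 (- (a^-1 * b))); apply: E; rewrite sigma_comp -sigma10.
  + by rewrite mulfV // mulrN mulVKf // addNr.
  + by rewrite mulVf // subrr.
Qed.

(** * Base change of eigengroup elements *)

Lemma map_sigma (K L : fieldType) (iota : {rmorphism K -> L}) (a b : K) g :
  map_poly iota (sigma a b g) = sigma (iota a) (iota b) (map_poly iota g).
Proof.
by rewrite /sigma map_comp_poly rmorphD /= map_polyZ map_polyX map_polyC.
Qed.

(** For the descent to [K]: since [f] is monic, the eigenvalue is the leading coefficient of the
    image of [f], hence lies in [K]; the eigenvector equation then descends because [iota] is
    injective on coefficients. *)
Lemma eigengroup_sigma_map (K L : fieldType) (iota : {rmorphism K -> L})
    (f : {poly K}) (a b : K) : f \is monic ->
  eigengroup f (sigma a b) <->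
  eigengroup (map_poly iota f) (sigma (iota a) (iota b)).
Proof.
move=> monf; split=> -[/AutPolyP [a' [b' [a'0 E]]] [c c0 fc]].
- have [Ea _] := sigma_inj E; split.
    by apply/AutPolyP; exists (iota a), (iota b); rewrite fmorph_eq0 Ea.
  exists (iota c); first by rewrite fmorph_eq0.
  by rewrite -map_sigma fc map_polyZ.
- have [Ea _] := sigma_inj E; split.
    by apply/AutPolyP; exists a, b; rewrite -(fmorph_eq0 iota) Ea.
  rewrite -map_sigma in fc.
  have cE : c = iota (lead_coef (sigma a b f)).
    rewrite -lead_coef_map fc lead_coefZ lead_coef_map (monicP monf).
    by rewrite rmorph1 mulr1.
  rewrite cE fmorph_eq0 in c0.
  exists (lead_coef (sigma a b f)) => //.
  by apply: (@map_poly_inj _ _ iota); rewrite fc map_polyZ -cE.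
Qed.

Lemma shift_eigengroup_sigma (L : fieldType) (f : {poly L}) (a b : L) :
  shift_eigengroup f (sigma a b) <-> a = 1 /\ eigengroup f (sigma a b).
Proof.
split=> [[G [mu _ /sigma_inj[a1 _]]] | [-> G]]; first by [].
by split=> //; exists b.
Qed.

(** * The cyclic group generated by one affine substitution *)

Lemma generated_subset (T : Type) (A H : set (T -> T)) :
  is_subgroup H -> A `<=` H -> generated A `<=` H.
Proof. by move=> sH AH; apply: smallest_sub. Qed.

(** The generator is the homothety [x -> nu + lambda (x - nu)], so its powers keep the centre [nu]
    and only the ratio changes. Natural exponents suffice because [lambda] has finite order. *)
Lemma generated_sigmaP (L : fieldType) n (lambda nu : L)
    (s : {poly L} -> {poly L}) : n.-primitive_root lambda ->
  generated [set sigma lambda ((1 - lambda) * nu)] s <->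
  exists i, s = sigma (lambda ^+ i) ((1 - lambda ^+ i) * nu).
Proof.
move=> prim.
have mulP i j : sigma (lambda ^+ i) ((1 - lambda ^+ i) * nu) \o
    sigma (lambda ^+ j) ((1 - lambda ^+ j) * nu) =
    sigma (lambda ^+ (i + j)) ((1 - lambda ^+ (i + j)) * nu).
  rewrite sigma_comp exprD mulrC; congr sigma.
  by rewrite mulrA -mulrDl mulrBr mulr1 addrC addrA subrK [X in 1 - X]mulrC.
split.
- apply: (generated_subset
    (H := [set s | exists i, s = sigma (lambda ^+ i) ((1 - lambda ^+ i) * nu)])).
  + split.
    * by exists 0; rewrite expr0 subrr mul0r sigma10.
    * by move=> _ _ [i ->] [j ->]; exists (i + j)%N.
    * move=> _ [i ->].
      have n1 m : lambda ^+ (n * m) = 1.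
        by rewrite exprM (prim_expr_order prim) expr1n.
      have E x y : (x + y = n * i)%N ->
          cancel (sigma (lambda ^+ x) ((1 - lambda ^+ x) * nu))
                 (sigma (lambda ^+ y) ((1 - lambda ^+ y) * nu)).
        move=> xy g; have := congr1 (fun h => h g) (mulP y x).
        by rewrite addnC xy n1 subrr mul0r sigma10.
      (* The exponent [n.-1 * i] plays the role of [- i], being congruent to it modulo [n]. *)
      exists (sigma (lambda ^+ (n.-1 * i)) ((1 - lambda ^+ (n.-1 * i)) * nu)).
        by exists (n.-1 * i)%N.
      have En : (i + n.-1 * i = n * i)%N.
        by rewrite -mulSn prednK // (prim_order_gt0 prim).
      by split; apply: E; rewrite // addnC.
  + by move=> _ ->; exists 1%N; rewrite expr1.
- move=> [i ->] H [[H1 HM _] sub]; elim: i => [|i IH].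
    by rewrite expr0 subrr mul0r sigma10.
  by have := HM _ _ IH (sub _ erefl); rewrite -{2 3}[lambda]expr1 mulP addn1.
Qed.

Lemma primitive_root1 (L : fieldType) n : n.-primitive_root (1 : L) -> n = 1%N.
Proof.
move=> prim; apply/eqP; rewrite -dvdn1.
by rewrite (prim_order_dvd prim) expr1n.
Qed.

(** * Elements of the eigengroup over the large field, and those defined over [K] *)

Section Decomposition.

Variables (L : fieldType) (g : {poly L}) (H : set ({poly L} -> {poly L})).
Variables (n : nat) (lambda nu : L) (V : set L).
Hypothesis decomp : cyclic_complement_with g H n lambda nu.
Hypothesis shiftV : shift_eigengroup g = [set sigma 1 mu | mu in V].
Hypothesis subspaceV : is_findim_subspace (prime_adjoin lambda) V.

Lemma subspaceN v : V v -> V (- v).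
Proof.
(* Every subfield contains [-1 = (1 - 1) - 1]. *)
case: subspaceV => _ _ VZ _ Vv; rewrite -mulN1r; apply: VZ => // F [[F1 FB _] _].
by rewrite -sub0r; apply: (FB) => //; rewrite -(subrr 1); apply: FB.
Qed.

Lemma subspaceXl v i : V v -> V (lambda ^+ i * v).
Proof.
case: subspaceV => _ _ VZ _ Vv; elim: i => [|i IH]; first by rewrite mul1r.
by rewrite exprS -mulrA; apply: VZ => // F [_]; apply.
Qed.

Lemma eigengroup_comp s t : eigengroup g s -> eigengroup g t ->
  eigengroup g (s \o t).
Proof. by case: decomp => _ _ [[[_ + _] _ _] _ _ _]; apply. Qed.

(** Composing the shift by [v] with the homothety of ratio [lambda ^+ i] turns [v] into
    [lambda ^+ i * v]; this stays in [V], a space over a field containing [lambda]. *)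
Lemma eigengroup_decompP (a b : L) :
  eigengroup g (sigma a b) <->
  exists i v, [/\ V v, a = lambda ^+ i & b = v + (1 - lambda ^+ i) * nu].
Proof.
have [prim HE [_ _ _ GE]] := decomp; rewrite GE HE shiftV; split.
- move=> [_ [v Vv <-] [t /(generated_sigmaP _ _ prim)[i ->]]].
  rewrite sigma_comp => /sigma_inj[<- <-]; exists i, (lambda ^+ i * v).
  by rewrite mulr1; split=> //; apply: subspaceXl.
- move=> [i [v [Vv -> ->]]].
  have n1 : lambda ^+ i * lambda ^+ (n.-1 * i) = 1.
    rewrite -exprD -mulSn prednK ?(prim_order_gt0 prim) //.
    by rewrite exprM (prim_expr_order prim) expr1n.
  (* The factor is the inverse of [lambda ^+ i] and cancels the twist. *)
  exists (sigma 1 (lambda ^+ (n.-1 * i) * v)).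
    by exists (lambda ^+ (n.-1 * i) * v) => //; apply: subspaceXl.
  exists (sigma (lambda ^+ i) ((1 - lambda ^+ i) * nu)).
    by apply/(generated_sigmaP _ _ prim); exists i.
  by rewrite sigma_comp mulr1 mulrA n1 mul1r.
Qed.

(** A trivial complement forces [lambda = 1], hence [n = 1], and the range [1 <= i <= n - 1] is
    empty. *)
Lemma complement_trivial_descends (K : fieldType) (iota : {rmorphism K -> L}) i :
  H = [set idfun] -> ~ descends_at iota V n lambda nu i.
Proof.
have [prim HE _] := decomp => H1 [ineq _ _ _].
have : H (sigma lambda ((1 - lambda) * nu)) by rewrite HE => F [_]; apply.
rewrite H1 /= -sigma10 => /sigma_inj[l1 _].
by move: prim ineq; rewrite l1 => /primitive_root1 ->; case: (i).
Qed.

Lemma eigengroup_nonshiftP (K : fieldType) (iota : {rmorphism K -> L}) :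
  (exists a b, a != 1 /\ eigengroup g (sigma (iota a) (iota b))) <->
  exists i, descends_at iota V n lambda nu i.
Proof.
have [prim _ _] := decomp; split; last first.
- move=> [i [/andP[i1 ilt] _ [a _ aE] [v [k [Vv vk]]]]].
  exists a, k; split.
    apply: contraL ilt => /eqP a1; move: aE; rewrite a1 rmorph1.
    move=> /esym/eqP; rewrite -(prim_order_dvd prim) => /(dvdn_leq i1) ni.
    by rewrite -ltnNge (leq_trans _ ni) // subn1 prednK // (prim_order_gt0 prim).
  apply/eigengroup_decompP; exists i, (- v); split=> //.
    exact: subspaceN.
  by rewrite vk addKr.
- move=> [a [b [a1 Gab]]].
  have /eigengroup_decompP[j [_ [_ aj _]]] := Gab.
  have {j aj} [i [i0 iltn ai]] : exists i, [/\ (0 < i)%N, (i < n)%N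
      & iota a = lambda ^+ i].
    (* The residue of [j] is nonzero because [a] differs from 1. *)
    exists (j %% n)%N; rewrite ltn_pmod ?(prim_order_gt0 prim) //.
    rewrite (prim_expr_mod prim); split=> //.
    rewrite lt0n; apply: contra a1; rewrite -[_ == 0]/(n %| j)%N.
    by rewrite (prim_order_dvd prim) -aj -(rmorph1 iota) (inj_eq (fmorph_inj iota)).
  (* Powers of the element keep both parameters in [K]; the exact constant term is irrelevant. *)
  have pow k : exists b', eigengroup g (sigma (iota a ^+ k) (iota b')).
    elim: k => [|k [b' IH]].
      exists 0; rewrite rmorph0 sigma10.
      by case: decomp => _ _ [[[]]].
    exists (a * b' + b); have := eigengroup_comp IH Gab.
    by rewrite sigma_comp -exprS rmorphD rmorphM.
  have [k m kE _] := egcdnP n i0.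
  have kd : lambda ^+ (i * k) = lambda ^+ gcdn i n.
    by rewrite mulnC kE exprD mulnC exprM (prim_expr_order prim) expr1n mul1r.
  (* The new exponent [j] need not equal the gcd, but only [lambda ^+ j] enters the formula. *)
  have [b' /eigengroup_decompP[j [v [Vv]]]] := pow k.
  rewrite ai -exprM kd => dj bE.
  exists (gcdn i n); split.
  + rewrite gcdn_gt0 i0 /= (leq_trans (dvdn_leq i0 (dvdn_gcdl i n))) //.
    by rewrite subn1 -ltnS prednK // (prim_order_gt0 prim).
  + exact: dvdn_gcdr.
  + by exists (a ^+ k) => //; rewrite rmorphXn /= ai -exprM kd.
  + exists (- v), b'; split; first exact: subspaceN.
    by rewrite bE addKr dj.
Qed.

End Decomposition.

(** * Triviality criteria in terms of the parameters *)

Lemma shift_eigengroup_trivialP (L : fieldType) (f : {poly L}) :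
  eigengroup f idfun ->
  shift_eigengroup f = [set idfun] <->
  forall b, eigengroup f (sigma 1 b) -> b = 0.
Proof.
move=> G1; split=> [E b Gb|E].
  have : shift_eigengroup f (sigma 1 b) by apply/shift_eigengroup_sigma.
  by rewrite E /= -sigma10 => /sigma_inj[].
apply/seteqP; split=> [s [Gs [b _ sE]]|_ ->].
  by move: Gs; rewrite -sE => /E ->; rewrite sigma10.
by split=> //; exists 0; rewrite ?sigma10.
Qed.

(** The criterion does not mention [H], so triviality is the same for all cyclic complements. If
    every eigengroup element is a shift, [H] lies in the shift subgroup, which it meets
    trivially. *)
Lemma complement_trivialP (L : fieldType) (f : {poly L})
    (H : set ({poly L} -> {poly L})) : cyclic_complement f H ->
  H = [set idfun] <-> ~ exists a b, a != 1 /\ eigengroup f (sigma a b).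
Proof.
move=> [m [lambda [nu [_ _ [[_ [N1 _ _] [H1 _ _]] _ NH GE]]]]]; split.
- move=> HE [a [b [/eqP a1]]]; rewrite GE HE => -[s Ns [_ ->]] sE.
  by apply: a1; move: Ns; rewrite [s]sE => /shift_eigengroup_sigma[].
- move=> noG; rewrite -NH; apply/seteqP; split=> [s Hs|s []//].
  split=> //.
  have Gs : eigengroup f s by rewrite GE; exists idfun => //; exists s.
  have [/AutPolyP[a [b [_ sE]]] _] := Gs.
  rewrite sE in Gs *; apply/shift_eigengroup_sigma; split=> //.
  by apply: contrapT => /eqP a1; apply: noG; exists a, b.
Qed.

Lemma eigengroup_trivialP (L : fieldType) (f : {poly L}) :
  eigengroup f idfun ->
  eigengroup f = [set idfun] <->
  shift_eigengroup f = [set idfun] /\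
  ~ exists a b, a != 1 /\ eigengroup f (sigma a b).
Proof.
move=> G1; split=> [E|[/(shift_eigengroup_trivialP G1) N1 noG]].
- split.
    apply/(shift_eigengroup_trivialP G1) => b.
    by rewrite E /= -sigma10 => /sigma_inj[].
  move=> [a [b [/eqP a1]]]; rewrite E /= -sigma10.
  by move=> /sigma_inj[].
- apply/seteqP; split=> [s Gs|_ -> //].
  have [/AutPolyP[a [b [_ sE]]] _] := Gs; rewrite sE in Gs *.
  have [a1|/eqP a1] := pselect (a = 1); last by case: noG; exists a, b.
  by rewrite a1 in Gs *; rewrite (N1 _ Gs) sigma10.
Qed.

(** * Triviality over [K] read off from the data over [Kbar] *)

Theorem proposition4p25
    (p : nat) (K : fieldType) (charK : p \in [pchar K])
    (Kbar : closedFieldType) (iota : {rmorphism K -> Kbar})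
    (closureK : is_algebraic_closure iota)
    (f : {poly K}) (monic_f : f \is monic)
    (roots_f : exists a b : Kbar,
       [/\ a != b, root (map_poly iota f) a & root (map_poly iota f) b])
    (Gbar : set ({poly Kbar} -> {poly Kbar}))
    (n : nat) (lambda nu : Kbar) (V : set Kbar)
    (decomp : cyclic_complement_with (map_poly iota f) Gbar n lambda nu)
    (shiftV : shift_eigengroup (map_poly iota f) = [set sigma 1 mu | mu in V])
    (subspaceV : is_findim_subspace (prime_adjoin lambda) V) :
  [/\ shift_eigengroup f = [set idfun] <-> V `&` range iota = [set 0],
      forall GbarK : set ({poly K} -> {poly K}),
        cyclic_complement f GbarK ->
        (GbarK = [set idfun] <->
         Gbar = [set idfun] \/
         [/\ Gbar <> [set idfun],
             Gbar = generated [set sigma lambda ((1 - lambda) * nu)]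
           & ~ exists i' : nat, descends_at iota V n lambda nu i'])
    & eigengroup f = [set idfun] <->
      eigengroup (map_poly iota f) = [set idfun] \/
      [/\ eigengroup (map_poly iota f) <> [set idfun],
          V `&` range iota = [set 0],
          Gbar = generated [set sigma lambda ((1 - lambda) * nu)]
        & ~ exists i' : nat, descends_at iota V n lambda nu i']].
Proof.
set fb := map_poly iota f.
have [_ HE [[[Gb1 _ _] _ _] _ _ GE]] := decomp.
have V0 : V 0 by case: subspaceV.
have G1 : eigengroup f idfun.
  rewrite -sigma10; apply/(eigengroup_sigma_map iota _ _ monic_f).
  by rewrite rmorph1 rmorph0 sigma10.
have VP v : V v <-> eigengroup fb (sigma 1 v).
  have <- : shift_eigengroup fb (sigma 1 v) <-> eigengroup fb (sigma 1 v).
    by split=> [/shift_eigengroup_sigma[]|Gv] //; apply/shift_eigengroup_sigma.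
  rewrite shiftV; split=> [Vv|[w Vw /sigma_inj[_ <-]] //]; by exists v.
have shiftP : shift_eigengroup f = [set idfun] <-> V `&` range iota = [set 0].
  rewrite (propext (shift_eigengroup_trivialP G1)); split=> [E|E b].
  - apply/seteqP; split=> [v [/VP Gv [k _ kE]]|_ ->]; last first.
      by split=> //; exists 0; rewrite ?rmorph0.
    move: Gv; rewrite -kE -(rmorph1 iota).
    by move=> /(eigengroup_sigma_map iota _ _ monic_f)/E ->; rewrite /= rmorph0.
  - move=> /(eigengroup_sigma_map iota _ _ monic_f); rewrite rmorph1 => /VP Vb.
    have : (V `&` range iota) (iota b) by split=> //; exists b.
    by rewrite E /= => /eqP; rewrite fmorph_eq0 => /eqP.
(* Over [K], non-shifts are the non-shifts over [Kbar] whose parameters come from [K]. *)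
have nonshiftP : (exists a b, a != 1 /\ eigengroup f (sigma a b)) <->
    exists i, descends_at iota V n lambda nu i.
  rewrite -(propext (eigengroup_nonshiftP decomp shiftV subspaceV iota)).
  by split=> -[a [b [a1 /(eigengroup_sigma_map iota _ _ monic_f) Gab]]];
    exists a, b.
have triv := complement_trivial_descends decomp (iota := iota).
split=> //.
- move=> GbarK /complement_trivialP; rewrite (propext nonshiftP) => ->.
  split=> [noD|[/triv D [i]|[]//]]; last exact: D.
  by have [|] := pselect (Gbar = [set idfun]); [left|right].
- rewrite (propext (eigengroup_trivialP G1)) (propext shiftP).
  rewrite (propext nonshiftP); split=> [[VK noD]|[E|[]//]].
    by have [|] := pselect (eigengroup fb = [set idfun]); [left|right].
  (* A trivial eigengroup over [Kbar] makes both [V] and the complement trivial, which excludes any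
     descending exponent. *)
  have decomp' : cyclic_complement fb Gbar by exists n, lambda, nu.
  have [Nb noGb] := (eigengroup_trivialP Gb1).1 E.
  split.
    apply/seteqP; split=> [v [/VP Gv _]|_ ->].
      exact: (shift_eigengroup_trivialP Gb1).1 Nb _ Gv.
    by split=> //; exists 0; rewrite ?rmorph0.
  by move=> [i]; apply: triv; apply/(complement_trivialP decomp').
Qed.
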